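(* Let $\beta\in(0,1)$, let $H$ be a separable Hilbert space, $G=(g_n)_{n=1}^\infty$ a frame for $H$, $G^d=(g_n^d)_{n=1}^\infty$ a dual frame of $G$, and $\mu_k(x)=e^{k|x|^\beta}$, $k\in\mathbb N_0$. Let $\Theta_k=\ell^2_{\mu_k}$, $\Theta_F=\bigcap_{k\in\mathbb N_0}\Theta_k$, $X_k=H^{\Theta_k}_{G,G^d}$, $X_F=\bigcap_{k\in\mathbb N_0}X_k$, and $M=\{(\langle f,g_n^d\rangle)_{n=1}^\infty : f\in H\}$. Assume that for every $k\in\mathbb N$, $M\cap\Theta_k\ne\{0\}$ and $M\cap\Theta_F$ is dense in $M\cap\Theta_k$ with respect to the norm of $\Theta_k$. Let $E=(e_n)_{n=1}^\infty$ be a sequence with elements from $X_F$ which is a frame for $H$. Then the following hold. (i) Assume that there exist constants $\gamma_0\in\mathbb N$, $C>0$ such that for every $k\in\mathbb N$ there exists $C_k>0$ with $$|\langle e_m,g_n\rangle|\le\begin{cases} C e^{\gamma_0 n^\beta}, & n>m,\\ C_k e^{k(n^\beta-m^\beta)}, & n\le m.\end{cases}$$ Then the analysis operator $U_E:f\mapsto(\langle f,e_m\rangle)_{m=1}^\infty$ is continuous from $X_F$ into $\mathfrak s^\beta$. (ii) Assume that there exist constants $\widetilde\gamma_0\in\mathbb N$, $\widetilde C>0$ such that for every $k\in\mathbb N$ there exists $\widetilde C_k>0$ with $$|\langle e_m,g_n^d\rangle|\le\begin{cases}\widetilde C e^{\widetilde\gamma_0 n^\beta}, & m>n,\\ \widetilde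 C_k e^{k(m^\beta-n^\beta)}, & m\le n.\end{cases}$$ Then the synthesis operator $T_E:(c_n)_{n=1}^\infty\mapsto\sum_{n=1}^\infty c_ne_n$ is continuous from $\mathfrak s^\beta$ into $X_F$. (iii) If the assumptions of both (i) and (ii) hold, then the frame operator $T_EU_E$ is continuous from $X_F$ into $X_F$.
   Context: $\mathbb N=\{1,2,\dots\}$, $\mathbb N_0=\mathbb N\cup\{0\}$. A frame for $H$ is a sequence $(g_n)$ in $H$ with $A\|f\|^2\le\sum_n|\langle f,g_n\rangle|^2\le B\|f\|^2$ for all $f\in H$ and some constants $A,B>0$. A dual frame of $(g_n)$ is a frame $(g_n^d)$ for $H$ with $f=\sum_n\langle f,g_n^d\rangle g_n=\sum_n\langle f,g_n\rangle g_n^d$ for all $f\in H$. $\ell^2_\mu$ is the space of complex sequences $(a_n)_{n=1}^\infty$ with norm $(\sum_{n=1}^\infty|a_n|^2\mu(n)^2)^{1/2}<\infty$. For a Banach sequence space $\Theta$ with continuous coordinate functionals, $H^{\Theta}_{G,G^d}$ is the Banach space of all $f\in H$ with $(\langle f,g_n^d\rangle)_{n=1}^\infty\in\Theta$, normed by $\|f\|=\|(\langle f,g_n^d\rangle)_n\|_\Theta$. $X_F$ carries the Fréchet topology given by the norms of $X_k$, $k\in\mathbb N_0$. $\mathfrak s^\beta$ is the Fréchet space of complex sequences $(a_n)_{n=1}^\infty$ with $\sup_n|a_n|e^{kn^\beta}<\infty$ for all $k\in\mathbb N_0$ (equivalently, here, $\mathfrak s^\beta=\Theta_F$), topologized by these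 norms. *)

(* Defs.v *)
From HB Require Import structures.
From mathcomp Require Import all_boot all_order all_algebra.
From mathcomp Require Import sesquilinear complex.
From mathcomp Require Import all_classical all_reals all_analysis.

Set Implicit Arguments.
Unset Strict Implicit.
Unset Printing Implicit Defensive.

Import Order.TTheory GRing.Theory Num.Theory.
Import numFieldNormedType.Exports.

Local Open Scope classical_set_scope.
Local Open Scope ring_scope.

(* All sequences (x_n)_{n >= 1} are functions on nat shifted by one:
   the value at n : nat is the term of index n.+1. *)

(* Norms of normed spaces over R[i] take values in R[i]; [rnorm] is the same
   norm with values in R. *)
Definition rnorm (R : realType) (V : normedZmodType R[i]) (x : V) : R :=
  complex.Re `|x|.

Definition separable (T : topologicalType) : Prop :=
  exists D : set T, countable D /\ dense D.

Section Frames.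
Context (R : realType) (H : completeNormedModType R[i]).
Variable dot : {dot H for (@Num.conj R[i])}.

Definition is_frame (g : nat -> H) : Prop :=
  exists A B : R, [/\ 0 < A, 0 < B &
    forall f : H,
      ((A * rnorm f ^+ 2)%:E <=
         \sum_(0 <= n <oo) (rnorm (dot f (g n)) ^+ 2)%:E)%E /\
      (\sum_(0 <= n <oo) (rnorm (dot f (g n)) ^+ 2)%:E <=
         (B * rnorm f ^+ 2)%:E)%E].

Definition is_dual_frame (g gd : nat -> H) : Prop :=
  is_frame gd /\
  forall f : H,
    series (fun n => dot f (gd n) *: g n) @ \oo --> f /\
    series (fun n => dot f (g n) *: gd n) @ \oo --> f.

Definition coeffs (g : nat -> H) (f : H) : nat -> R[i] :=
  fun n => dot f (g n).

(* H^Theta_{G,G^d} and its norm, for a sequence space with carrier [Theta]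
   and norm [N]. *)
Definition coorbit (gd : nat -> H) (Theta : set (nat -> R[i])) : set H :=
  [set f | Theta (coeffs gd f)].

Definition coorbit_norm (gd : nat -> H) (N : (nat -> R[i]) -> R) (f : H) : R :=
  N (coeffs gd f).

End Frames.

Section WeightedSequences.
Context (R : realType).

Definition l2w_sum (mu : R -> R) (a : nat -> R[i]) : \bar R :=
  (\sum_(0 <= n <oo) (rnorm (a n) ^+ 2 * mu n.+1%:R ^+ 2)%:E)%E.

Definition l2w (mu : R -> R) : set (nat -> R[i]) :=
  [set a | (l2w_sum mu a < +oo)%E].

Definition l2w_norm (mu : R -> R) (a : nat -> R[i]) : R :=
  Num.sqrt (fine (l2w_sum mu a)).

Definition subexp_weight (beta : R) (k : nat) (x : R) : R :=
  expR (k%:R * `|x| `^ beta).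

Definition sup_weighted (beta : R) (k : nat) (a : nat -> R[i]) : set R :=
  range (fun n : nat => rnorm (a n) * expR (k%:R * n.+1%:R `^ beta)).

End WeightedSequences.

(* The set P of vectors, with the topology given by the countable family of
   norms p: the coarsest one in which all balls of all the p k are open. *)
Record multinormed (R : realType) (V : zmodType) (P : set V)
  (p : nat -> V -> R) := Multinormed { vect : V ; _ : vect \in P }.

HB.instance Definition _ (R : realType) (V : zmodType) (P : set V)
  (p : nat -> V -> R) := [isSub for @vect R V P p].
HB.instance Definition _ (R : realType) (V : zmodType) (P : set V)
  (p : nat -> V -> R) := [Choice of multinormed P p by <:].

Section Multinormed.
Context (R : realType) (V : zmodType) (P : set V) (p : nat -> V -> R).
Local Notation T := (multinormed P p).

Definition norm_ball (k : nat) (x : T) (r : R) : set T :=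
  [set y : T | p k (vect y - vect x) < r].

Definition norm_balls : set (set T) :=
  [set B | exists (k : nat) (x : T) (r : R), 0 < r /\ B = norm_ball k x r].

HB.instance Definition _ := isSubBaseTopological.Build T norm_balls id.

End Multinormed.

Section Spaces.
Context (R : realType) (beta : R).

Definition Theta (k : nat) : set (nat -> R[i]) := l2w (subexp_weight beta k).
Definition Theta_norm (k : nat) : (nat -> R[i]) -> R :=
  l2w_norm (subexp_weight beta k).
Definition ThetaF : set (nat -> R[i]) := \bigcap_k Theta k.

Definition sbeta_set : set (nat -> R[i]) :=
  [set a | forall k, has_ubound (sup_weighted beta k a)].
Definition sbeta_norm (k : nat) (a : nat -> R[i]) : R :=
  sup (sup_weighted beta k a).
Definition sbeta := multinormed sbeta_set sbeta_norm.

Context (H : completeNormedModType R[i]).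
Variables (dot : {dot H for (@Num.conj R[i])}) (gd : nat -> H).

Definition X (k : nat) : set H := coorbit dot gd (Theta k).
Definition X_norm (k : nat) : H -> R := coorbit_norm dot gd (Theta_norm k).
Definition XF_set : set H := \bigcap_k X k.
Definition XF := multinormed XF_set X_norm.

Definition is_analysis_op (e : nat -> H) (U : XF -> sbeta) : Prop :=
  forall f : XF, vect (U f) = coeffs dot e (vect f).

(* As usual for frames, the series converges in the norm of H. *)
Definition is_synthesis_op (e : nat -> H) (T : sbeta -> XF) : Prop :=
  forall c : sbeta, series (fun n => vect c n *: e n) @ \oo --> vect (T c).

End Spaces.

Section Decay.
Context (R : realType) (beta : R) (H : completeNormedModType R[i]).
Variable dot : {dot H for (@Num.conj R[i])}.
Local Notation npow n := (n.+1%:R `^ beta).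

Definition analysis_decay (g e : nat -> H) : Prop :=
  exists (gamma0 : nat) (C : R), [/\ (0 < gamma0)%N, 0 < C &
    forall k : nat, (0 < k)%N -> exists2 Ck : R, 0 < Ck &
      forall m n : nat,
        rnorm (dot (e m) (g n)) <=
          if (m < n)%N then C * expR (gamma0%:R * npow n)
          else Ck * expR (k%:R * (npow n - npow m))].

(* For m > n the bound involves the smaller index n, so this is not the
   previous condition with the roles of m and n exchanged. *)
Definition synthesis_decay (gd e : nat -> H) : Prop :=
  exists (gamma0 : nat) (C : R), [/\ (0 < gamma0)%N, 0 < C &
    forall k : nat, (0 < k)%N -> exists2 Ck : R, 0 < Ck &
      forall m n : nat,
        rnorm (dot (e m) (gd n)) <=
          if (n < m)%N then C * expR (gamma0%:R * npow n)
          else Ck * expR (k%:R * (npow m - npow n))].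

End Decay.

(* Main.v *)
(* The two branches of each decay condition combine: for every k there are L, C
   with |<e_m, g_n>| e^(k m^beta) <= C e^(L n^beta) for all m, n in (i), and
   |<e_m, gd_n>| e^(k n^beta) <= C e^(L m^beta) in (ii). If j beta >= 2 then
   e^(j n^beta) >= n^2, so expanding f = sum_n <f, gd_n> g_n (resp. T c =
   sum_m c_m e_m) and controlling the coefficients by the seminorm of index
   L + j dominates the scalar series by a multiple of sum_n 1/n^2 <= 2. The
   same device compares the weighted l^2 norms of X_F with weighted suprema. *)

Require Import Defs.
From HB Require Import structures.
From mathcomp Require Import all_boot all_order all_algebra.
From mathcomp Require Import sesquilinear complex.
From mathcomp Require Import all_classical all_reals all_analysis.
From mathcomp Require Import ring lra.

Set Implicit Arguments.
Unset Strict Implicit.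
Unset Printing Implicit Defensive.

Import Order.TTheory GRing.Theory Num.Theory.
Import numFieldNormedType.Exports.

Local Open Scope classical_set_scope.
Local Open Scope ring_scope.

(** * Continuity for topologies generated by a countable family of norms *)

Lemma vectP (R : realType) (V : zmodType) (P : set V) (p : nat -> V -> R)
  (x : multinormed P p) : P (vect x).
Proof. by case: x => v Pv; exact: set_mem Pv. Qed.

Lemma open_norm_ball (R : realType) (V : zmodType) (P : set V)
    (p : nat -> V -> R) k (x : multinormed P p) (r : R) :
  0 < r -> open (norm_ball k x r).
Proof.
move=> r0; exists [set norm_ball k x r]; last by rewrite bigcup_set1.
by move=> _ ->; apply: finI_from1; exists k, x, r.
Qed.

(** The balls form a subbase: an open set is a union of finite intersections of balls, and preimages
    commute with finite intersections. *)
Lemma continuous_into_multinormed (R : realType) (V : zmodType) (P : set V)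
    (p : nat -> V -> R) (S : topologicalType) (f : S -> multinormed P p) :
  (forall k y r x, norm_ball k y r (f x) -> nbhs x (f @^-1` norm_ball k y r)) ->
  continuous f.
Proof.
move=> fN x A; rewrite nbhsE => -[_ [[D sD <-] [C DC Cfx]] BA].
have [E sE EC] := sD _ DC.
suff fC : nbhs x (f @^-1` C) by apply: filterS fC => z Cz; apply: BA; exists C.
rewrite -EC preimage_bigcap; apply: filter_bigI => i Ei.
have := sE i Ei; rewrite inE => -[k [y [r [_ iE]]]].
rewrite /= iE; apply: fN; rewrite -iE.
by move: Cfx; rewrite -EC; apply.
Qed.

(** Subbasic balls around [f x] need not be centred at [f x], so a triangle inequality for [q k] is
    required. It is assumed in a strict form, the one that the convexity argument for weighted l^2
    norms delivers. *)
Lemma continuous_multinormed (R : realType) (V W : zmodType)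
    (P : set V) (p : nat -> V -> R) (Q : set W) (q : nat -> W -> R)
    (f : multinormed P p -> multinormed Q q) :
  (forall k, p k 0 = 0) ->
  (forall u v, Q u -> Q v -> Q (u - v)) ->
  (forall k u v r s, Q u -> Q v -> q k u < r -> q k v < s ->
    q k (u + v) < r + s) ->
  (forall k, exists l, exists2 C : R, 0 < C & forall x y,
    q k (vect (f x) - vect (f y)) <= C * p l (vect x - vect y)) ->
  continuous f.
Proof.
move=> p0 QB qD fC; apply: continuous_into_multinormed => k y r x fxr.
have [l [C C0 {}fC]] := fC k.
have d0 : 0 < (r - q k (vect (f x) - vect y)) / C.
  by rewrite divr_gt0// subr_gt0.
apply: filterS (open_nbhs_nbhs (conj (open_norm_ball l x d0) _)); last first.
  by rewrite /norm_ball/= subrr p0.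
move=> z /= xz; rewrite /norm_ball/=.
rewrite -(subrKA (vect (f x))) -(subrK (q k (vect (f x) - vect y)) r).
have e0 : 0 < r - q k (vect (f x) - vect y) - C * p l (vect z - vect x).
  by rewrite subr_gt0 mulrC -ltr_pdivlMr.
(* [e] is the slack left in the triangle inequality; giving half of it to each summand keeps both
   inequalities strict. *)
set e := (X in 0 < X) in e0.
rewrite [ltRHS](_ : _ = (r - q k (vect (f x) - vect y) - e / 2) +
  (q k (vect (f x) - vect y) + e / 2)); last by lra.
apply: qD; rewrite ?ltrDl ?divr_gt0//; try by apply: QB; exact: vectP.
by apply: le_lt_trans (fC _ _) _; rewrite /e; move: e0; rewrite /e; lra.
Qed.

(** * The real-valued form of a complex-valued norm *)

Section RealNorm.
Context (R : realType).
Implicit Types V : normedZmodType R[i].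

Lemma rnormE V (x : V) : (rnorm x)%:C%C = `|x|.
Proof. by rewrite /rnorm RRe_real// normr_real. Qed.

Lemma rnorm_ge0 V (x : V) : 0 <= rnorm x.
Proof. by rewrite -lecR rnormE normr_ge0. Qed.

Lemma rnorm0 V : rnorm (0 : V) = 0.
Proof. by rewrite /rnorm normr0. Qed.

Lemma rnormN V (x : V) : rnorm (- x) = rnorm x.
Proof. by rewrite /rnorm normrN. Qed.

Lemma ler_rnormD V (x y : V) : rnorm (x + y) <= rnorm x + rnorm y.
Proof. by rewrite -lecR rmorphD/= !rnormE ler_normD. Qed.

Lemma ler_rnorm_sum V (u : nat -> V) m n :
  rnorm (\sum_(m <= i < n) u i) <= \sum_(m <= i < n) rnorm (u i).
Proof.
rewrite -lecR rmorph_sum/= rnormE.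
rewrite [leRHS](eq_bigr (fun i => `|u i|)) ?ler_norm_sum// => i _.
exact: rnormE.
Qed.

Lemma rnormM (a b : R[i]) : rnorm (a * b) = rnorm a * rnorm b.
Proof.
by apply: (@complexI R); rewrite rmorphM/= !rnormE normrM.
Qed.

Lemma rnormZ (V : normedModType R[i]) (a : R[i]) (x : V) :
  rnorm (a *: x) = rnorm a * rnorm x.
Proof.
by apply: (@complexI R); rewrite rmorphM/= !rnormE normrZ.
Qed.

End RealNorm.

(** * Elementary estimates for inverse squares and subexponential weights *)

Lemma sum_inv_sqr_le2 (R : realFieldType) n :
  \sum_(0 <= i < n) (i.+1%:R ^+ 2)^-1 <= 2 :> R.
Proof.
(* The sharper bound makes the induction pass: 1/x^2 <= 2/x - 2/(x+1) for x >= 1. *)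
suff : \sum_(0 <= i < n) (i.+1%:R ^+ 2)^-1 <= 2 - 2 / n.+1%:R :> R.
  by move/le_trans; apply; rewrite gerBl divr_ge0.
elim: n => [|n IH]; first by rewrite big_nil divr1 subrr.
rewrite big_nat_recr//=; apply: le_trans (lerD IH (lexx _)) _.
rewrite -[n.+2%:R]natr1; set x : R := n.+1%:R.
have x1 : 1 <= x by rewrite ler1n.
have x0 : 0 < x by apply: lt_le_trans x1.
rewrite -subr_ge0 [leRHS](_ : _ = (x - 1) / (x ^+ 2 * (x + 1))).
  by rewrite divr_ge0// ?mulr_ge0 ?exprn_ge0 ?subr_ge0//; lra.
field; lra.
Qed.

Section Weights.
Context (R : realType) (beta : R).
Local Notation npow n := (n.+1%:R `^ beta).

(** With j >= 2/beta, e^(j n^beta) = (e^(n^beta))^j >= n^(beta j) >= n^2, as e^t >= t and n >= 1. *)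
Lemma sqr_le_weight : 0 < beta ->
  exists j : nat, forall n : nat, n.+1%:R ^+ 2 <= expR (j%:R * npow n) :> R.
Proof.
move=> beta0; have b2 : 0 <= 2 / beta by rewrite divr_ge0// ltW.
exists (Num.bound (2 / beta)) => n; have := archi_boundP b2.
set j := Num.bound _; rewrite ltr_pdivrMr// => /ltW j2.
rewrite expRM_natl.
apply: (@le_trans _ _ (npow n ^+ j)); last first.
  rewrite lerXn2r ?nnegrE ?powR_ge0 ?expR_ge0//.
  by rewrite (le_trans _ (expR_ge1Dx _))// lerDr.
rewrite -(powR_mulrn j) ?powR_ge0// -powRrM -(powR_mulrn 2)// ler_powR ?ler1n//.
by rewrite mulrC.
Qed.

Lemma npow_le m n : 0 < beta -> (m <= n)%N -> npow m <= npow n.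
Proof. by move=> b0 mn; rewrite ge0_ler_powR ?nnegrE ?ler_nat// ltW. Qed.

End Weights.

(** * Weighted l^2 norms and weighted suprema *)

Lemma nneseries_term_le (R : realType) (u : nat -> R) n :
  (forall i, 0 <= u i) -> ((u n)%:E <= \sum_(0 <= i <oo) (u i)%:E)%E.
Proof.
move=> u0; apply: le_trans (nneseries_lim_ge n.+1 _); last first.
  by move=> i _ _; rewrite lee_fin.
by rewrite sumEFin lee_fin big_nat_recr//= lerDr sumr_ge0.
Qed.

Section SequenceSpaces.
Context (R : realType).
Implicit Types (mu : R -> R) (a b : nat -> R[i]).

Lemma l2w_sum_ge0 mu a : (0 <= l2w_sum mu a)%E.
Proof.
by apply: nneseries_ge0 => n _ _; rewrite lee_fin mulr_ge0 ?sqr_ge0.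
Qed.

(** Membership matters here: [fine] sends an infinite sum to 0. *)
Lemma l2w_normE mu a : l2w mu a -> l2w_sum mu a = (l2w_norm mu a ^+ 2)%:E.
Proof.
move=> afin; rewrite /l2w_norm sqr_sqrtr ?fine_ge0 ?l2w_sum_ge0// fineK//.
by rewrite ge0_fin_numE ?l2w_sum_ge0.
Qed.

Lemma l2w_norm_ge0 mu a : 0 <= l2w_norm mu a.
Proof. exact: sqrtr_ge0. Qed.

Lemma l2w_norm0 mu : l2w_norm mu (fun=> 0) = 0.
Proof.
rewrite /l2w_norm /l2w_sum eseries0 ?sqrtr0// => n _ _.
by rewrite rnorm0 expr0n mul0r.
Qed.

Lemma l2w_coeff_le mu a n : l2w mu a ->
  rnorm (a n) * mu n.+1%:R <= l2w_norm mu a.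
Proof.
(* Nothing is assumed on the sign of [mu], so absolute values are taken before squaring. *)
move=> aP; apply: le_trans (ler_norm _) _.
rewrite -(@ler_pXn2r _ 2%N) ?nnegrE ?l2w_norm_ge0//.
rewrite real_normK ?num_real// exprMn -lee_fin -l2w_normE//.
rewrite -[leLHS]/((fun i => rnorm (a i) ^+ 2 * mu i.+1%:R ^+ 2) n)%:E.
by apply: nneseries_term_le => i; rewrite mulr_ge0 ?sqr_ge0.
Qed.

(* The convexity inequality |x + y|^2 <= (s + t) (|x|^2 / s + |y|^2 / t), summed
   with s > ||a|| and t > ||b||, replaces the Minkowski inequality. *)
Lemma l2w_sumD_le mu a b (s t : R) : 0 < s -> 0 < t ->
  (l2w_sum mu (a + b)%R <=
    ((s + t) / s)%:E * l2w_sum mu a + ((s + t) / t)%:E * l2w_sum mu b)%E.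
Proof.
move=> s0 t0; have c0 u : 0 < u -> 0 <= (s + t) / u.
  by move=> u0; rewrite divr_ge0 ?addr_ge0// ltW.
have f0 c n : (0 <= (rnorm (c n : R[i]) ^+ 2 * mu n.+1%:R ^+ 2)%:E)%E.
  by rewrite lee_fin mulr_ge0 ?sqr_ge0.
rewrite /l2w_sum -!nneseriesZl; try by move=> n _; exact: f0.
rewrite -nneseriesD; try by move=> n _ _; rewrite mule_ge0 ?f0// lee_fin c0.
apply: lee_nneseries => n; first by move=> _ _; exact: f0.
move=> _; rewrite -!EFinM -EFinD lee_fin.
rewrite [_ / s * _]mulrA [_ / t * _]mulrA -mulrDl.
rewrite ler_wpM2r ?sqr_ge0//.
apply: (@le_trans _ _ ((rnorm (a n) + rnorm (b n)) ^+ 2)).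
  by rewrite lerXn2r ?nnegrE ?addr_ge0 ?rnorm_ge0// ler_rnormD.
set x := rnorm (a n); set y := rnorm (b n); rewrite -subr_ge0.
rewrite [leRHS](_ : _ = (t * x - s * y) ^+ 2 / (s * t)); last by field; lra.
by rewrite divr_ge0 ?sqr_ge0// mulr_ge0// ltW.
Qed.

Lemma l2wD mu a b : l2w mu a -> l2w mu b -> l2w mu (a + b).
Proof.
move=> aP bP; apply: le_lt_trans (l2w_sumD_le mu a b ltr01 ltr01) _.
by rewrite l2w_normE// l2w_normE// -!EFinM -EFinD ltry.
Qed.

Lemma l2wB mu a b : l2w mu a -> l2w mu b -> l2w mu (a - b).
Proof.
move=> aP bP; apply: l2wD => //; rewrite /l2w/= /l2w_sum.
by under eq_eseriesr do rewrite rnormN.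
Qed.

(** Taking [r] and [s] as the convexity weights bounds the sum by (r+s)/r * r^2 + (r+s)/s * s^2 =
    (r+s)^2. The strict bounds force [r] and [s] to be positive, so vanishing norms need no separate
    case. *)
Lemma l2w_normD_lt mu a b (r s : R) : l2w mu a -> l2w mu b ->
  l2w_norm mu a < r -> l2w_norm mu b < s -> l2w_norm mu (a + b) < r + s.
Proof.
move=> aP bP ar bs.
have r0 : 0 < r := le_lt_trans (l2w_norm_ge0 mu a) ar.
have s0 : 0 < s := le_lt_trans (l2w_norm_ge0 mu b) bs.
rewrite -(@ltr_pXn2r _ 2%N) ?nnegrE ?l2w_norm_ge0 ?addr_ge0 ?ltW//.
rewrite -lte_fin -l2w_normE; last exact: l2wD.
apply: le_lt_trans (l2w_sumD_le mu a b r0 s0) _.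
rewrite l2w_normE// l2w_normE// -!EFinM -EFinD lte_fin.
rewrite [ltRHS](_ : _ = (r + s) / r * r ^+ 2 + (r + s) / s * s ^+ 2); last first.
  by field; lra.
rewrite ltrD// ltr_pM2l ?divr_gt0 ?addr_gt0//.
  by rewrite ltr_pXn2r ?nnegrE ?l2w_norm_ge0// ltW.
by rewrite ltr_pXn2r ?nnegrE ?l2w_norm_ge0// ltW.
Qed.

(** The extra factor n makes the n-th squared term at most P^2/n^2, so the sum is at most 2 P^2 <=
    (2 P)^2. *)
Lemma l2w_bound mu a (P : R) : 0 <= P ->
  (forall n, rnorm (a n) * `|mu n.+1%:R| * n.+1%:R <= P) ->
  l2w mu a /\ l2w_norm mu a <= 2 * P.
Proof.
move=> P0 aP.
have aS : (l2w_sum mu a <= (2 * P ^+ 2)%:E)%E.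
  apply: lime_le.
    by apply: is_cvg_nneseries => n _ _; rewrite lee_fin mulr_ge0 ?sqr_ge0.
  apply: nearW => n; rewrite sumEFin lee_fin.
  apply: (@le_trans _ _ (\sum_(0 <= i < n) P ^+ 2 * (i.+1%:R ^+ 2)^-1)).
    apply: ler_sum => i _; rewrite ler_pdivlMr ?exprn_gt0//.
    rewrite -[mu _ ^+ 2]real_normK ?num_real// -!exprMn.
    by rewrite lerXn2r ?nnegrE ?mulr_ge0 ?rnorm_ge0.
  by rewrite -mulr_sumr mulrC ler_wpM2r ?sqr_ge0// sum_inv_sqr_le2.
have al : l2w mu a by apply: le_lt_trans aS _; rewrite ltry.
split=> //; move: aS; rewrite l2w_normE// lee_fin => aS.
rewrite -(@ler_pXn2r _ 2%N) ?nnegrE ?l2w_norm_ge0 ?mulr_ge0//.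
by apply: le_trans aS _; rewrite exprMn ler_wpM2r ?sqr_ge0//; lra.
Qed.

Context (beta : R).
Local Notation npow n := (n.+1%:R `^ beta).

Lemma subexp_weightS k n : subexp_weight beta k n.+1%:R = expR (k%:R * npow n).
Proof. by rewrite /subexp_weight normr_nat. Qed.

Lemma sup_weighted_le a k (P : R) :
  (forall n, rnorm (a n) * expR (k%:R * npow n) <= P) ->
  has_ubound (sup_weighted beta k a) /\ sbeta_norm beta k a <= P.
Proof.
move=> aP; have ubP : ubound (sup_weighted beta k a) P by move=> _ [n _ <-].
split; first by exists P.
by apply: ge_sup => //; eexists; exists 0%N.
Qed.

Lemma sbeta_coeff_le a k n : sbeta_set beta a ->
  rnorm (a n) * expR (k%:R * npow n) <= sbeta_norm beta k a.
Proof. by move=> aP; apply: ub_le_sup; [exact: aP|exists n]. Qed.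

Lemma sbeta_normD_le a b k : sbeta_set beta a -> sbeta_set beta b ->
  has_ubound (sup_weighted beta k (a + b)) /\
  sbeta_norm beta k (a + b) <= sbeta_norm beta k a + sbeta_norm beta k b.
Proof.
move=> aP bP; apply: sup_weighted_le => n.
apply: le_trans (lerD (sbeta_coeff_le k n aP) (sbeta_coeff_le k n bP)).
by rewrite -mulrDl ler_wpM2r ?expR_ge0// ler_rnormD.
Qed.

Lemma sbetaB a b : sbeta_set beta a -> sbeta_set beta b ->
  sbeta_set beta (a - b).
Proof.
move=> aP bP k; have [] // := @sbeta_normD_le a (- b) k aP => l.
have -> : sup_weighted beta l (- b) = sup_weighted beta l b; last exact: bP.
by apply: eq_imagel => n _; rewrite rnormN.
Qed.

Lemma sbeta_norm0 k : sbeta_norm beta k (fun=> 0) = 0.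
Proof.
rewrite /sbeta_norm (_ : sup_weighted _ _ _ = [set 0]) ?sup1//.
apply/seteqP; split => [_ [n _ <-]|_ ->] /=; first by rewrite rnorm0 mul0r.
by exists 0%N => //; rewrite rnorm0 mul0r.
Qed.

End SequenceSpaces.

(** * Bounds for frame elements and convergence of series in the Hilbert space *)

Section FrameSeries.
Context (R : realType) (H : completeNormedModType R[i]).
Variable dot : {dot H for (@Num.conj R[i])}.

(** A single term is dominated by the upper frame bound. This makes the functionals f -> <f, g_n>
    bounded uniformly in n. *)
Lemma frame_coeff_le g : is_frame dot g ->
  exists2 B : R, 0 < B & forall f n, rnorm (dot f (g n)) <= B * rnorm f.
Proof.
move=> [A [B [_ B0 gB]]]; exists (Num.sqrt B); first by rewrite sqrtr_gt0.
move=> f n; rewrite -(@ler_pXn2r _ 2%N) ?nnegrE ?mulr_ge0 ?rnorm_ge0//.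
rewrite exprMn sqr_sqrtr ?(ltW B0)// -lee_fin; apply: le_trans (gB f).2.
rewrite -[leLHS]/((fun i => rnorm (dot f (g i)) ^+ 2) n)%:E.
by apply: nneseries_term_le => i; exact: sqr_ge0.
Qed.

(** Testing the coefficient bound on f = g_n gives |g_n|^2 <= B |g_n|. *)
Lemma frame_norm_bounded g : (forall f : H, `|f| ^+ 2 = dot f f) ->
  is_frame dot g -> exists2 B : R, 0 < B & forall n, rnorm (g n) <= B.
Proof.
move=> dotE /frame_coeff_le[B B0 gB]; exists B => // n.
have [->|gn0] := eqVneq (g n) 0; first by rewrite rnorm0 ltW.
have gn_gt0 : 0 < rnorm (g n) by rewrite -ltcR rnormE normr_gt0.
have := gB (g n) n; rewrite -dotE expr2 rnormM.
by rewrite [rnorm `|_|]/rnorm normr_id -/(rnorm _) ler_pM2r.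
Qed.

Lemma dotC_rnorm x y : rnorm (dot x y) = rnorm (dot y x).
Proof.
rewrite hermC expr0 mul1r; apply: (@complexI R); rewrite !rnormE.
by rewrite norm_conjC.
Qed.

(** A partial sum within e/B of [l] changes the pairing with [z] by at most e, and its own pairing
    is at most K times a partial sum of 1/n^2. *)
Lemma dot_series_le z (B K : R) (u : nat -> H) l : 0 < B -> 0 <= K ->
  (forall x, rnorm (dot x z) <= B * rnorm x) ->
  (forall n, rnorm (dot (u n) z) <= K / n.+1%:R ^+ 2) ->
  series u @ \oo --> l -> rnorm (dot l z) <= 2 * K.
Proof.
move=> B0 K0 zB uK ul; apply/ler_addgt0Pr => e e0.
have eB0 : 0 < ((e / B)%:C)%C :> R[i] by rewrite ltcR divr_gt0.
have /cvgrPdist_lt /(_ _ eB0)[N _ /(_ N (leqnn N))/=] := ul.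
rewrite -rnormE ltcR => lN.
rewrite -(subrK (series u N) l) linearDl addrC.
apply: le_trans (ler_rnormD _ _) _; apply: lerD; last first.
  by apply: le_trans (zB _) _; rewrite mulrC -ler_pdivlMr// ltW.
rewrite /series/= linear_sumlz; apply: le_trans (ler_rnorm_sum _ _ _) _.
apply: (@le_trans _ _ (\sum_(0 <= i < N) K * (i.+1%:R ^+ 2)^-1)).
  by apply: ler_sum => i _; exact: uK.
by rewrite -mulr_sumr mulrC ler_wpM2r// sum_inv_sqr_le2.
Qed.

Lemma cvg_series_inv_sqr (u : nat -> H) (K : R) :
  (forall n, rnorm (u n) <= K / n.+1%:R ^+ 2) -> cvgn (series u).
Proof.
move=> uK; apply/cauchy_cvgP/cauchy_seriesP => e e0.
(* A positive element of [R[i]] is real, so the Cauchy criterion can be compared with that of the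
   real majorant [v]. *)
have re : (complex.Re e)%:C%C = e by rewrite RRe_real// gtr0_real.
have er0 : 0 < complex.Re e by rewrite -ltcR re.
pose v n : R := K / n.+1%:R ^+ 2.
have K0 : 0 <= K by have := le_trans (rnorm_ge0 _) (uK 0); rewrite expr1n divr1.
have v0 n : 0 <= v n by rewrite divr_ge0.
have cv : cvgn (series v).
  apply: nondecreasing_is_cvgn; first exact: nondecreasing_series.
  exists (2 * K) => _ [n _ <-]; rewrite /series/= -mulr_sumr mulrC.
  by rewrite ler_wpM2r// sum_inv_sqr_le2.
move/cauchy_cvgP/cauchy_seriesP/(_ _ er0) : cv; apply: filterS => n.
rewrite ger0_norm ?sumr_ge0// => ve; rewrite -re -rnormE ltcR.
apply: le_lt_trans (ler_rnorm_sum _ _ _) _; apply: le_lt_trans ve.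
by apply: ler_sum => i _; exact: uK.
Qed.

End FrameSeries.

(** * Uniform weighted forms of the decay conditions, and stability of the spaces under
    differences *)

Section Operators.
Context (R : realType) (beta : R) (beta0 : 0 < beta).
Context (H : completeNormedModType R[i]).
Variable dot : {dot H for (@Num.conj R[i])}.
Local Notation npow n := (n.+1%:R `^ beta).

Let weight_ge1 k n : 1 <= expR (k%:R * npow n) :> R.
Proof. by rewrite -expR0 ler_expR mulr_ge0 ?powR_ge0. Qed.

Let weightD k l n :
  expR ((k + l)%:R * npow n) = expR (k%:R * npow n) * expR (l%:R * npow n) :> R.
Proof. by rewrite natrD mulrDl expRD. Qed.

Lemma analysis_decay_weight g e : analysis_decay beta dot g e ->
  forall k : nat, exists l : nat, exists2 C : R, 0 < C & forall m n,
    rnorm (dot (e m) (g n)) * expR (k%:R * npow m) <= C * expR (l%:R * npow n).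
Proof.
(* The decay condition concerns positive indices only, hence [k.+1], which also covers k = 0. *)
move=> [gamma [C [_ C0 eC]]] k; have [D D0 eD] := eC k.+1 isT => {eC}.
exists (gamma + k.+1)%N, (C + D); first exact: addr_gt0.
move=> m n.
apply: (@le_trans _ _ (rnorm (dot (e m) (g n)) * expR (k.+1%:R * npow m))).
  rewrite ler_wpM2l ?rnorm_ge0// ler_expR.
  by rewrite ler_wpM2r ?powR_ge0// ler_nat.
apply: le_trans (ler_wpM2r (expR_ge0 _) (eD m n)) _ => {eD}.
(* For m < n the weight in m is at most the one in n; for n <= m it cancels the factor e^(-(k+1)
   m^beta). *)
case: ifP => [mn|_].
  rewrite -mulrA weightD; apply: ler_pM.
  - exact: ltW.
  - by rewrite mulr_ge0 ?expR_ge0.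
  - by rewrite lerDl ltW.
  - rewrite ler_wpM2l ?expR_ge0// ler_expR ler_wpM2l//.
    by apply: npow_le => //; exact: ltnW.
rewrite -mulrA -expRD -mulrDr subrK weightD; apply: ler_pM.
- exact: ltW.
- exact: expR_ge0.
- by rewrite lerDr ltW.
- by rewrite ler_peMl ?expR_ge0 ?weight_ge1.
Qed.

(** Enlarging the smaller index in the first branch to the larger one weakens the hypothesis to the
    analysis condition, with [e] in the place of [g] and [gd] in the place of [e]; conjugate
    symmetry swaps the arguments. *)
Lemma synthesis_decay_weight gd e : synthesis_decay beta dot gd e ->
  forall k : nat, exists l : nat, exists2 C : R, 0 < C & forall m n,
    rnorm (dot (e m) (gd n)) * expR (k%:R * npow n) <= C * expR (l%:R * npow m).
Proof.
move=> [gamma [C [gamma0 C0 eC]]].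
have dC : analysis_decay beta dot e gd.
  exists gamma, C; split; [exact: gamma0|exact: C0|move=> k k0 {gamma0}].
  have [D D0 eD] := eC k k0 => {eC k0}; exists D; first exact: D0.
  move=> m n; rewrite dotC_rnorm; apply: le_trans (eD n m) _ => {eD}.
  case: ifP => [mn|_]; last by rewrite lexx.
  rewrite ler_wpM2l ?(ltW C0)// ler_expR ler_wpM2l//.
  by apply: npow_le => //; exact: ltnW.
move=> k; have [l [D D0 eD]] := analysis_decay_weight dC k.
exists l, D; first exact: D0.
by move=> m n; rewrite dotC_rnorm; exact: eD.
Qed.

(** Of the weight of index l + j carried by [a], the part l absorbs the growth of <v_n, z> and the
    part j pays for 1/n^2. The factor [W] is a weight attached to the fixed vector [z]. *)
Lemma dot_weighted_series_le z B (C P W : R) (l j : nat) (a : nat -> R[i])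
    (v : nat -> H) f : 0 < B -> 0 <= C -> 0 < W ->
  (forall x, rnorm (dot x z) <= B * rnorm x) ->
  (forall n, n.+1%:R ^+ 2 <= expR (j%:R * npow n) :> R) ->
  (forall n, rnorm (a n) * expR ((l + j)%:R * npow n) <= P) ->
  (forall n, rnorm (dot (v n) z) * W <= C * expR (l%:R * npow n)) ->
  series (fun n => a n *: v n) @ \oo --> f -> rnorm (dot f z) * W <= 2 * (C * P).
Proof.
move=> B0 C0 W0 zB jn aP vC avf.
have P0 : 0 <= P by apply: le_trans (aP 0%N); rewrite mulr_ge0 ?rnorm_ge0 ?expR_ge0.
rewrite -ler_pdivlMr// -mulrA; apply: dot_series_le zB _ avf => //.
  by rewrite divr_ge0 ?mulr_ge0// ltW.
move=> n; rewrite linearZl_LR rnormM ler_pdivlMr ?exprn_gt0// ler_pdivlMr//.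
rewrite (_ : _ * W = rnorm (dot (v n) z) * W * (rnorm (a n) * n.+1%:R ^+ 2));
  last by ring.
apply: (@le_trans _ _ (C * expR (l%:R * npow n) *
    (rnorm (a n) * expR (j%:R * npow n)))).
  rewrite ler_pM ?mulr_ge0 ?rnorm_ge0 ?(ltW W0)//.
  by rewrite ler_wpM2l ?rnorm_ge0.
rewrite -mulrA ler_wpM2l//; apply: le_trans (aP n).
by rewrite weightD mulrCA mulrA.
Qed.

Lemma coeffsB h (f f' : H) : coeffs dot h (f - f') = coeffs dot h f - coeffs dot h f'.
Proof. by apply/funext => n; rewrite /coeffs linearBl. Qed.

Lemma coeffs0 h : coeffs dot h 0 = fun=> 0.
Proof. by apply/funext => n; rewrite /coeffs linear0l. Qed.

Lemma XF_setB gd f f' : XF_set beta dot gd f -> XF_set beta dot gd f' ->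
  XF_set beta dot gd (f - f').
Proof.
move=> fX f'X k _; rewrite /X /coorbit/= coeffsB.
by apply: l2wB; [exact: fX|exact: f'X].
Qed.

Lemma X_norm0 gd k : X_norm beta dot gd k 0 = 0.
Proof. by rewrite /X_norm /coorbit_norm coeffs0 /Theta_norm l2w_norm0. Qed.

Lemma X_normD_lt gd k (f f' : H) (r s : R) :
  XF_set beta dot gd f -> XF_set beta dot gd f' ->
  X_norm beta dot gd k f < r -> X_norm beta dot gd k f' < s ->
  X_norm beta dot gd k (f + f') < r + s.
Proof.
move=> fX f'X; rewrite /X_norm /coorbit_norm.
rewrite (_ : coeffs dot gd (f + f') = coeffs dot gd f + coeffs dot gd f').
  by apply: l2w_normD_lt; [exact: fX|exact: f'X].
by apply/funext => n; rewrite /coeffs linearDl.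
Qed.

(** * The analysis operator *)

Section Analysis.
Variables (g gd e : nat -> H).
Hypotheses (hgd : is_dual_frame dot g gd) (he : is_frame dot e).
Hypothesis hd : analysis_decay beta dot g e.

(** The weighted series bound is applied to f = sum_n <f, gd_n> g_n with z = e_m; the constants do
    not depend on m, which allows a supremum. *)
Lemma analysis_coeff_le k : exists l : nat, exists2 C : R, 0 < C &
  forall f, XF_set beta dot gd f -> forall m,
    rnorm (dot f (e m)) * expR (k%:R * npow m) <= C * X_norm beta dot gd l f.
Proof.
have [B B0 eB] := frame_coeff_le he.
have [l [C C0 eC]] := analysis_decay_weight hd k.
have [j jn] := sqr_le_weight beta0.
exists (l + j)%N, (2 * C); first by rewrite mulr_gt0.
move=> f fX m; rewrite -mulrA.
apply: (dot_weighted_series_le B0 (ltW C0) (expR_gt0 _) (eB ^~ m) jn) (hgd.2 f).1.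
  move=> n; rewrite -subexp_weightS.
  exact: (l2w_coeff_le n (fX (l + j)%N I)).
by move=> n; rewrite dotC_rnorm.
Qed.

Lemma analysis_op_continuous :
  exists U : XF beta dot gd -> sbeta beta, is_analysis_op e U /\ continuous U.
Proof.
have Us f : XF_set beta dot gd f -> sbeta_set beta (coeffs dot e f).
  by move=> fX k; have [l [C _ /(_ _ fX)/sup_weighted_le[]]] := analysis_coeff_le k.
exists (fun f => Multinormed _ (mem_set (Us _ (vectP f)))); split=> //.
apply: continuous_multinormed.
- exact: X_norm0.
- exact: sbetaB.
- move=> k a b r s aS bS ar bs.
  by apply: le_lt_trans (sbeta_normD_le k aS bS).2 _; exact: ltrD.
- move=> k; have [l [C C0 lC]] := analysis_coeff_le k.
  exists l, C => // x y; rewrite /= -coeffsB.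
  have xyX := XF_setB (vectP x) (vectP y).
  by have [] := sup_weighted_le (lC _ xyX).
Qed.

End Analysis.

(** * The synthesis operator *)

Section Synthesis.
Variables (gd e : nat -> H).
Hypothesis dotE : forall f : H, `|f| ^+ 2 = dot f f.
Hypotheses (hgd : is_frame dot gd) (he : is_frame dot e).
Hypothesis hd : synthesis_decay beta dot gd e.

Lemma synthesis_cvg c : sbeta_set beta c -> cvgn (series (fun n => c n *: e n)).
Proof.
move=> cS; have [B B0 eB] := frame_norm_bounded dotE he.
have [j jn] := sqr_le_weight beta0.
apply: (@cvg_series_inv_sqr _ _ _ (sbeta_norm beta j c * B)) => n.
rewrite ler_pdivlMr ?exprn_gt0// rnormZ mulrAC ler_pM ?mulr_ge0 ?rnorm_ge0//.
by apply: le_trans (sbeta_coeff_le j n cS); rewrite ler_wpM2l ?rnorm_ge0.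
Qed.

(** Stated for any sum [f] of the series, so that it also applies to a difference of two sums. *)
Lemma synthesis_norm_le k : exists l : nat, exists2 C : R, 0 < C &
  forall c f, sbeta_set beta c -> series (fun n => c n *: e n) @ \oo --> f ->
    X beta dot gd k f /\ X_norm beta dot gd k f <= C * sbeta_norm beta l c.
Proof.
have [B B0 gB] := frame_coeff_le hgd.
have [j jn] := sqr_le_weight beta0.
(* The gain j is spent twice: in k + j to pass from pointwise bounds on <f, gd_n> to the l^2 norm,
   and in l + j to sum over m. Each summation costs a factor 2. *)
have [l [C C0 eC]] := synthesis_decay_weight hd (k + j).
exists (l + j)%N, (2 * (2 * C)); first by rewrite !mulr_gt0.
move=> c f cS cf; rewrite -mulrA.
have fle n : rnorm (dot f (gd n)) * expR ((k + j)%:R * npow n) <=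
    2 * C * sbeta_norm beta (l + j) c.
  rewrite -mulrA.
  apply: (dot_weighted_series_le B0 (ltW C0) (expR_gt0 _) (gB ^~ n) jn) cf => m.
    exact: sbeta_coeff_le.
  exact: eC.
apply: l2w_bound => [|n].
  by apply: le_trans (fle 0%N); rewrite mulr_ge0 ?rnorm_ge0 ?expR_ge0.
apply: le_trans (fle n); rewrite subexp_weightS ger0_norm ?expR_ge0//.
rewrite weightD -mulrA !ler_wpM2l ?rnorm_ge0 ?expR_ge0//.
by apply: le_trans (jn n); rewrite expr2 ler_peMl ?ler1n.
Qed.

Lemma synthesis_op_continuous :
  exists T : sbeta beta -> XF beta dot gd, is_synthesis_op e T /\ continuous T.
Proof.
pose S c := limn (series (fun n => c n *: e n)) : H.
have SX c : sbeta_set beta c -> XF_set beta dot gd (S c).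
  move=> cS k _; have [l [C _ lC]] := synthesis_norm_le k.
  by have [] := lC _ _ cS (synthesis_cvg cS).
exists (fun c => Multinormed _ (mem_set (SX _ (vectP c)))); split=> /=.
  by move=> c; apply: synthesis_cvg; exact: vectP.
apply: continuous_multinormed.
- exact: sbeta_norm0.
- exact: XF_setB.
- exact: X_normD_lt.
- move=> k; have [l [C C0 lC]] := synthesis_norm_le k.
  exists l, C => // x y /=.
  have xyS := sbetaB (vectP x) (vectP y).
  apply: (lC _ _ xyS _).2.
  (* The series with coefficients x - y converges to the difference of the two limits, so the norm
     estimate yields the Lipschitz bound. *)
  rewrite (_ : series _ = series (fun n => vect x n *: e n) -
                          series (fun n => vect y n *: e n)).
    by apply: cvgB; apply: synthesis_cvg; exact: vectP.
  apply/funext => n; apply: etrans (sumrB _ _ _ _).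
  by apply: eq_bigr => i _; exact: scalerBl.
Qed.

End Synthesis.
End Operators.

(** * Continuity of the analysis, synthesis and frame operators *)

Theorem proposition4p3 (R : realType) (beta : R) (hbeta : 0 < beta < 1)
  (H : completeNormedModType R[i]) (dot : {dot H for (@Num.conj R[i])})
  (hdot : forall f : H, `|f| ^+ 2 = dot f f)
  (hsep : separable H)
  (g gd : nat -> H) (hg : is_frame dot g) (hgd : is_dual_frame dot g gd)
  (M : set (nat -> R[i])) (hM : M = range (coeffs dot gd))
  (hne : forall k : nat, (0 < k)%N ->
     M `&` Theta beta k <> [set (fun=> 0)])
  (hdense : forall k : nat, (0 < k)%N ->
     forall x, (M `&` Theta beta k) x -> forall eps : R, 0 < eps ->
     exists2 y, (M `&` ThetaF beta) y & Theta_norm beta k (x - y) < eps)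
  (e : nat -> H) (heX : forall n, XF_set beta dot gd (e n))
  (he : is_frame dot e) :
  [/\ analysis_decay beta dot g e ->
        exists U : XF beta dot gd -> sbeta beta,
          is_analysis_op e U /\ continuous U,
      synthesis_decay beta dot gd e ->
        exists T : sbeta beta -> XF beta dot gd,
          is_synthesis_op e T /\ continuous T &
      analysis_decay beta dot g e -> synthesis_decay beta dot gd e ->
        exists (U : XF beta dot gd -> sbeta beta)
               (T : sbeta beta -> XF beta dot gd),
          [/\ is_analysis_op e U, is_synthesis_op e T & continuous (T \o U)]].
Proof.
case/andP: hbeta => beta0 _; split.
- exact: analysis_op_continuous.
- exact: synthesis_op_continuous hgd.1 he.
- move=> dU dT.
  have [U [UE Uc]] := analysis_op_continuous beta0 hgd he dU.
  have [T [TE Tc]] := synthesis_op_continuous beta0 hdot hgd.1 he dT.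
  by exists U, T; split=> // x; apply: continuous_comp; [exact: Uc|exact: Tc].
Qed.
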